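(* Let $G$ be a binate group and let $Q$ be a group that is residually of finite virtual cohomological dimension. Then every group homomorphism $G\rightarrow Q$ is trivial.
   Context: Write $[u,v]=uvu^{-1}v^{-1}$. A nontrivial group $G$ is called binate if for every finitely generated subgroup $H$ of $G$ there exist a homomorphism $\varphi_H:H\rightarrow G$ (called a structure map) and an element $u_H\in G$ (called a structure element) such that $h=[u_H,\varphi_H(h)]$ for all $h\in H$. A group has finite virtual cohomological dimension if it has a subgroup of finite index whose cohomological dimension (over $\mathbb{Z}$) is finite. A group $Q$ is residually of finite virtual cohomological dimension if for every $q\in Q$ with $q\neq 1$ there is a homomorphism from $Q$ to a group of finite virtual cohomological dimension which maps $q$ to a nontrivial element. *)

(* Defs.v *)
From HB Require Import structures.
From mathcomp Require Import all_boot all_algebra.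

Set Implicit Arguments.
Unset Strict Implicit.
Unset Printing Implicit Defensive.

Import GRing.Theory.

Local Open Scope group_scope.

Notation group_hom := UMagmaMorphism.type.

(* fingroup's [~ u, v] is u^-1 v^-1 u v, so the convention u v u^-1 v^-1 needs
   its own definition. *)
Definition commutator (G : groupType) (u v : G) : G := u * v * u^-1 * v^-1.

(* Subgroups are boolean predicates; classically every subgroup is of this
   form. *)
Section Subgroup.
Variables (G : groupType) (H : groupClosed G).

Record subgroup := Subgroup { subgroup_val : G; _ : subgroup_val \in H }.

HB.instance Definition _ := [isSub for subgroup_val].
HB.instance Definition _ := [Choice of subgroup by <:].

Lemma subgroup_group_closed : group_closed [pred x | x \in H].
Proof. by split=> [|x y]; [exact: gpred1 | exact: gpredF]. Qed.

HB.instance Definition _ :=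
  SubChoice_isSubGroup.Build G [pred x | x \in H] subgroup
    subgroup_group_closed.

Definition generated_by (s : seq G) : Prop :=
  {subset s <= H} /\
  forall K : groupClosed G, {subset s <= K} -> {subset H <= K}.

Definition finitely_generated : Prop := exists s : seq G, generated_by s.

Definition finite_index : Prop :=
  exists s : seq G, forall x : G, exists2 t, t \in s & t^-1 * x \in H.

End Subgroup.

Definition binate (G : groupType) : Prop :=
  (exists g : G, g <> 1) /\
  forall H : groupClosed G, finitely_generated H ->
    exists (phi : group_hom (subgroup H) G) (u : G),
      forall h : subgroup H, val h = commutator u (phi h).

(* Left modules over the integral group ring of G, presented as abelian groups
   with an additive action of G. *)
HB.mixin Record isGModule (G : groupType) V of GRing.Zmodule V := {
  gact : G -> V -> V;
  gact1 : forall v, gact 1 v = v;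
  gactM : forall g h v, gact (g * h) v = gact g (gact h v);
  gactD : forall g v w, gact g (v + w)%R = (gact g v + gact g w)%R
}.

#[short(type="gmodType")]
HB.structure Definition GModule (G : groupType) :=
  { V of isGModule G V & GRing.Zmodule V }.

Definition trivial_int (G : groupType) : Type := int.

HB.instance Definition _ (G : groupType) := GRing.Zmodule.on (trivial_int G).
HB.instance Definition _ (G : groupType) :=
  @isGModule.Build G (trivial_int G) (fun _ n => n)
    (fun _ => erefl) (fun _ _ _ => erefl) (fun _ _ _ => erefl).

Section CohomologicalDimension.
Variable G : groupType.

Record gmod_hom (M N : gmodType G) := GModHom {
  gmod_fun :> {additive M -> N};
  gmod_funJ : forall (g : G) (x : M), gmod_fun (gact g x) = gact g (gmod_fun x)
}.

Definition gmod_surj (M N : gmodType G) (f : gmod_hom M N) : Prop :=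
  forall y : N, exists x : M, f x = y.

Definition exact_at (L M N : gmodType G) (f : gmod_hom L M)
    (g : gmod_hom M N) : Prop :=
  forall x : M, g x = 0%R <-> exists y : L, f y = x.

Definition projective (P : gmodType G) : Prop :=
  forall (M N : gmodType G) (p : gmod_hom M N) (f : gmod_hom P N),
    gmod_surj p -> exists l : gmod_hom P M, forall x, p (l x) = f x.

(* 0 -> P n -> ... -> P 1 -> P 0 -> Z -> 0, stored as an infinite resolution
   whose terms vanish beyond n. *)
Record projective_resolution (n : nat) := ProjectiveResolution {
  res_mod : nat -> gmodType G;
  res_diff : forall i, gmod_hom (res_mod i.+1) (res_mod i);
  res_aug : gmod_hom (res_mod 0) (trivial_int G);
  res_proj : forall i, projective (res_mod i);
  res_aug_surj : gmod_surj res_aug;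
  res_exact0 : exact_at (res_diff 0) res_aug;
  res_exact : forall i, exact_at (res_diff i.+1) (res_diff i);
  res_length : forall i, n < i -> forall x : res_mod i, x = 0%R
}.

Definition cd_le (n : nat) : Prop := inhabited (projective_resolution n).

Definition finite_cd : Prop := exists n, cd_le n.

End CohomologicalDimension.

Definition finite_vcd (G : groupType) : Prop :=
  exists H : groupClosed G, finite_index H /\ finite_cd (subgroup H).

Definition residually_finite_vcd (Q : groupType) : Prop :=
  forall q : Q, q <> 1 ->
    exists (V : groupType) (f : group_hom Q V), finite_vcd V /\ f q <> 1.

(* Main.v *)
Require Import Defs.
From HB Require Import structures.
From mathcomp Require Import all_boot all_algebra.
From mathcomp Require Import boolp finmap monalg.

Set Implicit Arguments.
Unset Strict Implicit.
Unset Printing Implicit Defensive.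

Import GRing.Theory.

(** Write [H] for a finitely generated subgroup of a binate group G, with
structure map phi and structure element u. Both h and [u phi(h) u^-1 = h phi(h)]
depend multiplicatively on h, which forces phi(H) to commute with H
([binate_step]). This has two consequences for a homomorphism f from G to a
group V of finite virtual cohomological dimension.

If V acts on a finite set, take for H a group which already has the full image
of G in that action. The image of phi(H) is then central, so every commutator
[[u, phi(h)]] acts trivially, and with it all of G. Hence f lands in every
subgroup of finite index, in particular in one of finite cohomological
dimension n ([binate_finite_index]).

Now fix x and iterate the structure maps along larger and larger lists. This
gives commuting elements y_0, y_1, ... with [u_i y_i u_i^-1 = x y_i], where u_i
commutes with y_j for j > i ([binate_tower]). If a power f(y_i)^m lies in the
subgroup generated by the f(y_j) with j > i, it commutes with f(u_i), and
conjugating it by f(u_i) gives f(x)^m = 1. A group of cohomological dimension n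
is torsion free, so that f(x) <> 1 would make the f(y_i) independent, and V
would contain free abelian groups of every rank, which also contradicts finite
dimension.

The two bounds on groups of dimension n ([cd_le_torsion_free] and
[cd_le_independent]) come from following the class of 1 along a projective
resolution P of the trivial module. For an element c of finite order m the
operators c - 1 and 1 + c + ... + c^(m-1) alternately have each other's image as
kernel on P, and the class survives in all degrees ([cyclic_acyclic_res]). For
independent commuting elements t_1, ..., t_k the operators t_i - 1 form a
regular sequence on P, and each of them moves the class up by one degree
([coinvariants_class]), whence k <= n. Both properties of P are inherited by
direct summands from free modules, where they are read off from the orbits on a
basis ([regular_free] and [cyclic_acyclic_free]). *)

Local Open Scope group_scope.

(** * Generated subgroups *)

Section Generated.
Variables (G : groupType) (s : seq G).

Inductive in_generated : G -> Prop :=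
| InGenerated_mem x of x \in s : in_generated x
| InGenerated_one : in_generated 1
| InGenerated_mul x y of in_generated x & in_generated y : in_generated (x * y)
| InGenerated_inv x of in_generated x : in_generated x^-1.

Definition generated : {pred G} := fun x => `[< in_generated x >].

Lemma generatedP x : reflect (in_generated x) (x \in generated).
Proof. exact: asboolP. Qed.

Lemma mem_generated x : x \in s -> x \in generated.
Proof. by move=> sx; apply/generatedP; exact: InGenerated_mem. Qed.

Fact generated_mulg_closed :
  {in generated &, forall x y, x * y \in generated}.
Proof.
by move=> x y /generatedP gx /generatedP gy; apply/generatedP;
  exact: InGenerated_mul.
Qed.

Fact generated_one_closed : 1 \in generated.
Proof. by apply/generatedP; exact: InGenerated_one. Qed.

Fact generated_invg_closed : {in generated, forall x, x^-1 \in generated}.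
Proof.
by move=> x /generatedP gx; apply/generatedP; exact: InGenerated_inv.
Qed.

HB.instance Definition _ :=
  isMulClosed.Build G generated generated_mulg_closed.
HB.instance Definition _ :=
  isMul1Closed.Build G generated generated_one_closed.
HB.instance Definition _ :=
  isInvClosed.Build G generated generated_invg_closed.

Lemma generated_finitely_generated : finitely_generated generated.
Proof.
exists s; split=> [x|K sK x /generatedP]; first exact: mem_generated.
by elim=> {x} [x /sK||x y _ Kx _ Ky|x _ Kx] //;
  [exact: gpred1 | exact: gpredM | rewrite gpredV].
Qed.

End Generated.

Lemma generated_commute (G : groupType) (s : seq G) (u : G) :
  {in s, forall x, commute u x} -> {in generated s, forall x, commute u x}.
Proof.
move=> su x /generatedP; elim=> {x} [x /su||x y _ ux _ uy|x _ ux] //.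
- exact: commute1.
- exact: commuteM.
- exact: commuteV.
Qed.

Lemma generated_cyclic (G : groupType) (c : G) (m : nat) x :
  (0 < m)%N -> c ^+ m = 1 -> x \in generated [:: c] ->
  exists2 i, (i < m)%N & x = c ^+ i.
Proof.
move=> m_gt0 cm1.
suff gen_pow : in_generated [:: c] x -> exists i, x = c ^+ i.
  move=> /generatedP/gen_pow[i ->]; exists (i %% m)%N; first exact: ltn_pmod.
  by rewrite {1}(divn_eq i m) expgnDr mulnC expgnA cm1 expg1n mul1g.
elim=> {x} [x||x y _ [i ->] _ [j ->]|x _ [i ->]].
- by rewrite inE => /eqP->; exists 1%N; rewrite expg1.
- by exists 0%N.
- by exists (i + j)%N; rewrite expgnDr.
- exists (m.-1 * i)%N; apply: (mulgI (c ^+ i)); rewrite mulgV -expgnDr.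
  by rewrite -mulSn prednK // expgnA cm1 expg1n.
Qed.

(** * Binate groups *)

Section Binate.
Variables (G : groupType) (binG : binate G).

(** Since both h and [phi h] are multiplicative in h, so is [h * phi h], which
    is the conjugate of [phi h] by u; this forces the image of [phi] to
    centralise the subgroup on which it is defined. *)
Lemma binate_step (s : seq G) : exists yu : (G -> G) * G,
  {in s, forall h, h = commutator yu.2 (yu.1 h)} /\
  {in s &, forall h k, commute (yu.1 h) k}.
Proof.
have [phi [u phiP]] := binG.2 _ (generated_finitely_generated s).
pose y h := if insub h is Some k then phi k else 1.
have yE k : y (val k) = phi k by rewrite /y valK.
have genS h : h \in s -> exists k : subgroup (generated s), h = val k.
  by move=> /mem_generated gh; exists (Sub h gh); rewrite SubK.
have conj k : u * phi k * u^-1 = val k * phi k.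
  by rewrite phiP /commutator mulgVK.
exists (y, u); split=> [h /genS[k ->]|h h' /genS[k ->] /genS[k' ->]] /=.
  by rewrite yE; exact: phiP.
rewrite yE /commute; have := conj (k * k')%g.
rewrite !gmulfM -!mulgA.
have -> : u * (phi k * (phi k' * u^-1)) =
    (u * phi k * u^-1) * (u * phi k' * u^-1).
  by rewrite !mulgA mulgVK.
rewrite !conj !mulgA => /mulIg; rewrite -!mulgA => /mulgI.
exact.
Qed.

(** The group G acts on the cosets of H through a finite group. On finitely many
    elements with all possible actions the structure map takes values whose
    actions are central, so the commutators with these values act trivially. *)
Lemma binate_finite_index (V : groupType) (f : group_hom G V)
  (H : groupClosed V) : finite_index H -> forall x, f x \in H.
Proof.
move=> [s sP].
(* The elements that act trivially on the cosets of H. *)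
pose core v := forall w : V, w^-1 * v * w \in H.
(* The action of [f g] on the cosets of H, recorded as a 0-1 matrix. *)
pose beta (g : G) : {ffun 'I_(size s) * 'I_(size s) -> bool} :=
  [ffun ij => (tnth (in_tuple s) ij.1)^-1 * f g * tnth (in_tuple s) ij.2 \in H].
have betaP g g' : beta g = beta g' -> core ((f g)^-1 * f g').
  move=> eq_beta w; have [_ /seq_tnthP[i ->] Hw] := sP w.
  have [_ /seq_tnthP[j ->] Hgw] := sP (f g' * tnth (in_tuple s) i).
  move: Hw Hgw; set ti := tnth _ i; set tj := tnth _ j => Hw Hgw.
  have Hgi : tj^-1 * f g * ti \in H.
    by move/ffunP/(_ (j, i)): eq_beta; rewrite !ffunE /= => ->; rewrite -mulgA.
  rewrite (_ : _ * w =
      (ti^-1 * w)^-1 * (tj^-1 * f g * ti)^-1 * (tj^-1 * (f g' * ti)) *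
      (ti^-1 * w)).
    by do !apply: gpredM => //; rewrite gpredV.
  by rewrite !invgM !invgK !mulgA !mulgK.
have [c cP] : {c : {ffun 'I_(size s) * 'I_(size s) -> bool} -> G &
    forall b g, beta g = b -> beta (c b) = b}.
  apply: (@choice _ _ (fun b y => forall g, beta g = b -> beta y = b)) => b.
  have [[g gb]|nb] := pselect (exists g, beta g = b); first by exists g.
  by exists 1 => g gb; case: nb; exists g.
have [[y u] [/= comm_y y_comm]] := binate_step [seq c b | b : {ffun _ -> bool}].
have mem_c b : c b \in [seq c b | b : {ffun _ -> bool}].
  by apply: map_f; rewrite mem_enum.
have coreV v : core v -> core v^-1.
  by move=> cv w; rewrite -gpredV !invgM !invgK mulgA.
move=> x; have xP := betaP _ _ (cP _ x erefl).
have uP := betaP _ _ (cP _ u erefl).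
(* In the formula for h, the structure element u may be replaced by a, which
   commutes with [y h]. *)
move: (comm_y _ (mem_c (beta x))).
move: (y_comm _ _ (mem_c (beta x)) (mem_c (beta u))).
move: (c (beta x)) (c (beta u)) xP uP => h a xP uP.
move=> /(gmulf_commute f) ba hE.
have fhH : f h \in H.
  move: uP; rewrite hE /commutator !gmulfM !gmulfV.
  set b := f (y h); set k := _^-1 * f u => uP.
  rewrite (_ : f u * b * (f u)^-1 * b^-1 = (f a * k * (f a)^-1) *
     ((b^-1 * (f a)^-1)^-1 * k^-1 * (b^-1 * (f a)^-1))).
    apply: gpredM; last exact: coreV.
    by have := uP (f a)^-1; rewrite invgK.
  have ba' : b^-1 * (f a)^-1 = (f a)^-1 * b^-1 by rewrite -!invgM -/b ba.
  by rewrite !invgM !invgK -!mulgA mulKg ba' /k !mulVKg.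
have := xP 1; rewrite invg1 mul1g mulg1 => Hhx.
by rewrite -(mulVKg (f h) (f x)) gpredM.
Qed.

End Binate.

Section BinateTower.
Variables (G : groupType) (binG : binate G) (x : G).

(** Iterating the structure maps at x, each time on a list that contains all
    elements produced so far. *)
Lemma binate_tower : exists y u : nat -> G,
  [/\ forall i, x = commutator (u i) (y i),
      forall i, commute (y i) x,
      forall i j, (i < j)%N -> commute (y j) (y i) &
      forall i j, (i < j)%N -> commute (y j) (u i)].
Proof.
have [F FP] := choice (binate_step binG).
pose next s := [:: (F s).2, (F s).1 x & s].
pose st i := iter i next [:: x].
have xst i : x \in st i.
  by elim: i => [|i IH] /=; rewrite !inE ?eqxx // IH !orbT.
have st_sub i j : (i < j)%N -> {subset next (st i) <= st j}.
  elim: j => // j IH; rewrite ltnS leq_eqVlt => /predU1P[-> //|/IH sub_ij].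
  by move=> z /sub_ij zj; rewrite /= !inE zj !orbT.
have yst i j z : (i < j)%N -> z \in next (st i) -> commute ((F (st j)).1 x) z.
  by move=> /st_sub sub_ij /sub_ij zj; apply: (FP (st j)).2.
exists (fun i => (F (st i)).1 x), (fun i => (F (st i)).2).
split=> [i|i|i j ij|i j ij].
- exact: (FP (st i)).1.
- by apply: (FP (st i)).2.
- by apply: (yst i) => //; rewrite !inE eqxx orbT.
- by apply: (yst i) => //; rewrite !inE eqxx.
Qed.

End BinateTower.

(** * Group rings acting on modules *)

Local Open Scope ring_scope.

Section Diff.
Variable (G : groupType).
Implicit Types (M : gmodType G) (g t c : G).

Section OneModule.
Variable M : gmodType G.
Implicit Types x y z : M.

Lemma gact_zmod_morphism g : zmod_morphism (gact g : M -> M).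
Proof.
have gact0 : gact g 0 = 0 :> M.
  by apply: (addIr (gact g 0)); rewrite -gactD !add0r.
have gactN x : gact g (- x) = - gact g x.
  by apply/eqP; rewrite -addr_eq0 -gactD addNr gact0.
by move=> x y; rewrite gactD gactN.
Qed.

HB.instance Definition _ g :=
  GRing.isZmodMorphism.Build M M (gact g) (gact_zmod_morphism g).

Definition gdiff g x : M := gact g x - x.

Fact gdiff_zmod_morphism g : zmod_morphism (gdiff g).
Proof. by move=> x y; rewrite /gdiff raddfB !opprD addrACA. Qed.

HB.instance Definition _ g :=
  GRing.isZmodMorphism.Build M M (gdiff g) (gdiff_zmod_morphism g).

Lemma gdiffC g h x : commute g h -> gdiff g (gdiff h x) = gdiff h (gdiff g x).
Proof.
move=> gh; rewrite /gdiff !raddfB /= -!gactM gh.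
by rewrite -!addrA; congr (_ + _); rewrite addrCA.
Qed.

Definition cyclic_norm c (m : nat) x : M := \sum_(i < m) gact (c ^+ i)%g x.

Fact cyclic_norm_zmod_morphism c m : zmod_morphism (cyclic_norm c m).
Proof.
move=> x y; rewrite /cyclic_norm -sumrB.
by apply: eq_bigr => i _; rewrite raddfB.
Qed.

HB.instance Definition _ c m :=
  GRing.isZmodMorphism.Build M M (cyclic_norm c m)
    (cyclic_norm_zmod_morphism c m).

Lemma gdiff_cyclic_norm c m x :
  (c ^+ m = 1)%g -> gdiff c (cyclic_norm c m x) = 0.
Proof.
move=> cm1; rewrite /gdiff /cyclic_norm raddf_sum /= -sumrB.
under eq_bigr do rewrite -gactM -expgS.
rewrite -(big_mkord xpredT (fun i => gact (c ^+ i.+1)%g x - gact (c ^+ i)%g x)).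
by rewrite telescope_sumr // cm1 expg0 subrr.
Qed.

Lemma cyclic_norm_gdiff c m x :
  (c ^+ m = 1)%g -> cyclic_norm c m (gdiff c x) = 0.
Proof.
move=> cm1; rewrite -(gdiff_cyclic_norm x cm1) /cyclic_norm /gdiff.
rewrite raddf_sum -sumrB.
by apply: eq_bigr => i _; rewrite raddfB /= -!gactM -expgS -expgSr.
Qed.

(** This is I M, for I the augmentation ideal of the group ring of the subgroup
    generated by [ts]; the recursive form lets the elements of [ts] be treated
    one at a time. *)
Fixpoint aug_span (ts : seq G) x : Prop :=
  if ts is t :: ts' then exists y z, aug_span ts' z /\ x = gdiff t y + z
  else x = 0.

Lemma aug_span0 ts : aug_span ts 0.
Proof.
by elim: ts => //= t ts IH; exists 0, 0; split=> //; rewrite raddf0 addr0.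
Qed.

Lemma aug_spanB ts x y : aug_span ts x -> aug_span ts y -> aug_span ts (x - y).
Proof.
elim: ts x y => [|t ts IH] x y /=; first by move=> -> ->; rewrite subrr.
move=> [x1 [x2 [Sx2 ->]]] [y1 [y2 [Sy2 ->]]].
exists (x1 - y1), (x2 - y2).
by split; [exact: IH | rewrite raddfB opprD addrACA].
Qed.

Lemma aug_spanN ts x : aug_span ts x -> aug_span ts (- x).
Proof. by rewrite -[- x]add0r; apply: aug_spanB; exact: aug_span0. Qed.

Lemma aug_spanD ts x y : aug_span ts x -> aug_span ts y -> aug_span ts (x + y).
Proof. by move=> Sx /aug_spanN; rewrite -{2}[y]opprK; exact: aug_spanB. Qed.

Lemma aug_span_cons t ts x : aug_span ts x -> aug_span (t :: ts) x.
Proof. by exists 0, x; rewrite raddf0 add0r. Qed.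

Lemma aug_span_mem ts t x : t \in ts -> aug_span ts (gdiff t x).
Proof.
elim: ts => // t' ts IH; rewrite inE => /predU1P[->|/IH Sx].
  by exists x, 0; split; [exact: aug_span0 | rewrite addr0].
exact: aug_span_cons.
Qed.

Lemma aug_span_generated ts g x : g \in generated ts -> aug_span ts (gdiff g x).
Proof.
move=> /generatedP gg; elim: {g} gg x => [t ts_t|| g h _ IHg _ IHh|g _ IHg] x.
- exact: aug_span_mem.
- by rewrite /gdiff gact1 subrr; exact: aug_span0.
- rewrite (_ : gdiff _ x = gdiff g (gact h x) + gdiff h x).
    exact: aug_spanD.
  by rewrite /gdiff gactM addrA subrK.
- rewrite (_ : gdiff _ x = - gdiff g (gact g^-1%g x)); first exact: aug_spanN.
  by rewrite /gdiff -gactM mulgV gact1 opprB.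
Qed.

Lemma aug_span_gdiff ts g x : {in ts, forall t, commute g t} ->
  aug_span ts x -> aug_span ts (gdiff g x).
Proof.
elim: ts x => [|t ts IH] x /= gts; first by move->; rewrite raddf0.
move=> [y [z [Sz ->]]]; exists (gdiff g y), (gdiff g z); split.
  by apply: IH => // t' t't; apply: gts; rewrite inE t't orbT.
by rewrite raddfD /= gdiffC //; apply: gts; rewrite mem_head.
Qed.

(** Read from the end of the list, each difference t - 1 is injective on the
    quotient of M by the images of the preceding ones. *)
Fixpoint regular (ts : seq G) : Prop :=
  if ts is t :: ts' then
    regular ts' /\ forall x, aug_span ts' (gdiff t x) -> aug_span ts' x
  else True.

(** Vanishing of the Tate cohomology, with coefficients in M, of a cyclic group
    of order m whose generator acts as c. *)
Definition cyclic_acyclic c m : Prop :=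
  forall x, (gdiff c x = 0 -> exists y, x = cyclic_norm c m y) /\
            (cyclic_norm c m x = 0 -> exists y, x = gdiff c y).

End OneModule.

Lemma gmod_gdiff (M N : gmodType G) (f : gmod_hom M N) g x :
  f (gdiff g x) = gdiff g (f x).
Proof. by rewrite /gdiff raddfB gmod_funJ. Qed.

Lemma gmod_cyclic_norm (M N : gmodType G) (f : gmod_hom M N) c m x :
  f (cyclic_norm c m x) = cyclic_norm c m (f x).
Proof.
rewrite /cyclic_norm raddf_sum.
by apply: eq_bigr => i _; rewrite gmod_funJ.
Qed.

Lemma gmod_aug_span (M N : gmodType G) (f : gmod_hom M N) ts x :
  aug_span ts x -> aug_span ts (f x).
Proof.
elim: ts x => [|t ts IH] x /=; first by move=> ->; rewrite raddf0.
move=> [y [z [Sz ->]]]; exists (f y), (f z).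
by rewrite raddfD gmod_gdiff; split; first exact: IH.
Qed.

Section Retract.
Variables (M N : gmodType G) (i : gmod_hom M N) (p : gmod_hom N M).
Hypothesis pi : forall x, p (i x) = x.

Lemma regular_retract ts : regular N ts -> regular M ts.
Proof.
elim: ts => //= t ts IH [/IH regM regN]; split=> // x /(gmod_aug_span i).
by rewrite gmod_gdiff => /regN/(gmod_aug_span p); rewrite pi.
Qed.

Lemma cyclic_acyclic_retract c m : cyclic_acyclic N c m -> cyclic_acyclic M c m.
Proof.
move=> acN x; split=> [dx0|nx0].
  have [|y /(congr1 p)] := (acN (i x)).1.
    by rewrite -gmod_gdiff dx0 raddf0.
  by rewrite pi gmod_cyclic_norm; exists (p y).
have [|y /(congr1 p)] := (acN (i x)).2.
  by rewrite -gmod_cyclic_norm nx0 raddf0.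
by rewrite pi gmod_gdiff; exists (p y).
Qed.

End Retract.

Section Resolution.
Variables (n : nat) (P : projective_resolution G n).

Lemma res_dd i (x : res_mod P i.+2) : res_diff P i (res_diff P i.+1 x) = 0.
Proof. by apply/res_exact; exists x. Qed.

Section RegularChase.
Variable A : {pred G}.
Hypothesis abA : {in A &, forall g h, commute g h}.

(** The homology of the coinvariants of P under the group generated by [ts]
    vanishes in degrees above the length of [ts]: by the long exact sequence of
    the injective operator t - 1, each t costs one more degree. *)
Lemma coinvariants_exact ts (tsA : {subset ts <= A}) :
    (forall i, regular (res_mod P i) ts) ->
  forall i (x : res_mod P i.+1), (size ts <= i)%N ->
    aug_span ts (res_diff P i x) ->
  exists y, aug_span ts (x - res_diff P i.+1 y).
Proof.
elim: ts tsA => [|t ts IH] tsA /= regts.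
  by move=> i x _ /res_exact[y <-]; exists y; rewrite subrr.
have At : t \in A by apply: tsA; rewrite mem_head.
have tsA' : {subset ts <= A} by move=> g tg; apply: tsA; rewrite inE tg orbT.
have t_ts : {in ts, forall g, commute t g} by move=> g /tsA' Ag; exact: abA.
have {}IH := IH tsA' (fun i => (regts i).1).
case=> // i x; rewrite ltnS => le_i [y [z [Sz dx]]].
have Sdy : aug_span ts (res_diff P i y).
  apply: (regts i).2; rewrite -gmod_gdiff.
  rewrite (_ : gdiff t y = res_diff P i.+1 x - z); last by rewrite dx addrK.
  rewrite raddfB res_dd sub0r; apply: aug_spanN.
  exact: gmod_aug_span.
(* Correcting x by w makes it a cycle modulo the shorter list. *)
have [w Sw] := IH i y le_i Sdy.
have [|v Sv] := IH i.+1 (x - gdiff t w) (leqW le_i).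
  rewrite raddfB gmod_gdiff dx addrAC -raddfB.
  by apply: aug_spanD => //; apply: aug_span_gdiff.
exists v, w, (x - gdiff t w - res_diff P i.+2 v); split=> //.
by rewrite addrA [gdiff t w + _]addrC subrK.
Qed.

(** The element x represents a generator of the top homology of the free abelian
    group with basis [ts]. It comes from an element of augmentation 1: the
    difference t - 1 sends x to a boundary, and a preimage represents the class
    for the longer list. That all of A kills the class is
    what makes the induction go through. *)
Lemma coinvariants_class ts (tsA : {subset ts <= A}) :
    (forall i, regular (res_mod P i) ts) ->
  exists x : res_mod P (size ts),
    {in A, forall g, exists y, aug_span ts (gdiff g x - res_diff P _ y)} /\
    ~ exists y, aug_span ts (x - res_diff P _ y).
Proof.
elim: ts tsA => [|t ts IH] tsA /= regts.
  have [x xP] := res_aug_surj P 1%R; exists x; split=> [g _|].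
    have /res_exact0[y <-] : res_aug P (gdiff g x) = 0.
      by rewrite gmod_gdiff /gdiff xP; exact: subrr.
    by exists y; rewrite subrr.
  move=> [y /eqP]; rewrite subr_eq0 => /eqP xy.
  have /res_exact0 : exists y, res_diff P 0 y = x by exists y.
  by rewrite xP.
have At : t \in A by apply: tsA; rewrite mem_head.
have tsA' : {subset ts <= A} by move=> g tg; apply: tsA; rewrite inE tg orbT.
have t_ts : {in ts, forall g, commute t g} by move=> g /tsA' Ag; exact: abA.
have regts' i := (regts i).1.
have [x [xA nx]] := IH tsA' regts'.
have [x' Sx'] := xA t At; exists x'; split=> [g Ag|[v [y [z [Sz x'E]]]]].
  have [w Sw] := xA g Ag.
  have g_ts : {in ts, forall h, commute g h} by move=> h /tsA' Ah; exact: abA.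
  have [|v Sv] := coinvariants_exact tsA' regts' (x := gdiff t w - gdiff g x')
    (leqnn _).
    rewrite raddfB !gmod_gdiff.
    have -> : gdiff t (res_diff P _ w) - gdiff g (res_diff P _ x') =
        gdiff g (gdiff t x - res_diff P _ x') -
        gdiff t (gdiff g x - res_diff P _ w).
      rewrite [in RHS]raddfB [gdiff t (_ - _)]raddfB /= (gdiffC _ (abA Ag At)).
      by rewrite [- (gdiff t _ - _)]opprB [RHS]addrC [RHS]addrA subrK.
    by apply: aug_spanB; exact: aug_span_gdiff.
  exists (- v), w, (- (gdiff t w - gdiff g x' - res_diff P _ v)); split.
    exact: aug_spanN.
  by rewrite raddfN opprK -(addrA (gdiff t w)) -(opprD (gdiff g x')) subKr.
apply: nx; exists y; apply: (regts _).2.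
rewrite raddfB /= -gmod_gdiff.
have dx'E : res_diff P _ x' = res_diff P _ (gdiff t y) + res_diff P _ z.
  by rewrite -(subrK (res_diff P _ v) x') x'E !raddfD res_dd addr0.
have -> : gdiff t x - res_diff P _ (gdiff t y) =
    gdiff t x - res_diff P _ x' + res_diff P _ z.
  by rewrite dx'E opprD (addrA (gdiff t x)) subrK.
by apply: aug_spanD => //; exact: gmod_aug_span.
Qed.

Lemma regular_size ts (tsA : {subset ts <= A}) :
  (forall i, regular (res_mod P i) ts) -> (size ts <= n)%N.
Proof.
move=> /(coinvariants_class tsA)[x [_ nx]]; rewrite leqNgt; apply/negP => lt_n.
apply: nx; exists 0; rewrite (res_length lt_n x) raddf0 subrr.
exact: aug_span0.
Qed.

End RegularChase.

(** Over a cyclic group the norm and the difference alternate as connecting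
    maps, so that the class of 1 survives in every degree. *)
Lemma cyclic_acyclic_res c m : (c ^+ m = 1)%g ->
  (forall i, cyclic_acyclic (res_mod P i) c m) -> m = 1%N.
Proof.
move=> cm1 acP; apply/eqP/negP => /negP m_neq1.
pose op b (M : gmodType G) : {additive M -> M} :=
  if b then cyclic_norm c m : {additive M -> M}
  else gdiff c : {additive M -> M}.
have opop b M (x : M) : op (~~ b) M (op b M x) = 0.
  by case: b; [exact: gdiff_cyclic_norm | exact: cyclic_norm_gdiff].
have opJ b (M N : gmodType G) (f : gmod_hom M N) x :
    f (op b M x) = op b N (f x).
  by case: b; [exact: gmod_cyclic_norm | exact: gmod_gdiff].
have opE b i (x : res_mod P i) : op b _ x = 0 -> exists y, x = op (~~ b) _ y.
  by case: b; [exact: (acP i x).2 | exact: (acP i x).1].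
suff class i : exists x : res_mod P i,
    (exists y, op (odd i) _ x = res_diff P i y) /\
    ~ exists y z, x = res_diff P i y + op (~~ odd i) _ z.
  have [x [_ []]] := class n.+1; exists 0, 0.
  by rewrite (res_length (ltnSn n) x) !raddf0 addr0.
elim: i => [|i [x [[y xy] nx]]] /=.
  have [x xP] := res_aug_surj P 1%R; exists x; split.
    have /res_exact0[y <-] : res_aug P (gdiff c x) = 0.
      by rewrite gmod_gdiff /gdiff xP; exact: subrr.
    by exists y.
  move=> [y [z xE]]; have : res_aug P x = (res_aug P z : int) *+ m.
    rewrite xE raddfD (_ : res_aug P (res_diff P 0 y) = 0).
      rewrite add0r gmod_cyclic_norm /cyclic_norm.
      by rewrite (eq_bigr (fun=> res_aug P z)) // sumr_const card_ord.
    by apply/res_exact0; exists y.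
  rewrite xP => /(congr1 absz) /=.
  rewrite -mulr_natr natz abszM absz_nat => /esym/eqP.
  by rewrite muln_eq1 (negbTE m_neq1) andbF.
exists y; split.
  have /res_exact[z <-] : res_diff P i (op (~~ odd i) _ y) = 0.
    by rewrite opJ -xy opop.
  by exists z.
move=> [v [w yE]]; apply: nx; rewrite negbK in yE.
have /opE[z zE] : op (odd i) _ (x - res_diff P i w) = 0.
  by rewrite raddfB xy yE raddfD res_dd add0r opJ subrr.
by exists w, z; rewrite -zE addrC subrK.
Qed.

End Resolution.

End Diff.

(** * Free modules *)

Section FormalSums.
Variable K : choiceType.
Implicit Types z : {malg K}.

Lemma malg_basis_ind (Q : {malg K} -> Prop) :
    Q 0 -> (forall x y, Q x -> Q y -> Q (x - y)) -> (forall k, Q << k >>) ->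
  forall z, Q z.
Proof.
move=> Q0 QB Qk z.
have QN x : Q x -> Q (- x) by rewrite -[- x]add0r; exact: QB.
have QD x y : Q x -> Q y -> Q (x + y).
  by move=> Qx /QN; rewrite -{2}[y]opprK; exact: QB.
rewrite [z]monalgE; elim/big_ind: _ => // k _.
have QMn i : Q (<< k >> *+ i) by elim: i => // i IH; rewrite mulrS; exact: QD.
rewrite -[z@_k]intz -mulrzr mul1r raddfMz.
by case: (z@_k) => i; [exact: QMn | apply: QN; exact: QMn].
Qed.

Section Lift.
Variables (W : zmodType) (h : K -> W).

Definition malg_lift z : W := \sum_(k <- msupp z) h k *~ z@_k.

Lemma malg_liftEw (D : {fset K}) z : (msupp z `<=` D)%fset ->
  malg_lift z = \sum_(k <- D) h k *~ z@_k.
Proof.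
move=> zD; apply: big_fset_incl => // k _ /mcoeff_outdom->.
by rewrite mulr0z.
Qed.

Fact malg_lift_zmod_morphism : zmod_morphism malg_lift.
Proof.
move=> x y; set D := (msupp x `|` msupp y)%fset.
rewrite (@malg_liftEw D) ?msuppB_le // (@malg_liftEw D x) ?fsubsetUl //.
rewrite (@malg_liftEw D y) ?fsubsetUr // -sumrB.
by apply: eq_bigr => k _; rewrite mcoeffB mulrzBr.
Qed.

HB.instance Definition _ :=
  GRing.isZmodMorphism.Build {malg K} W malg_lift malg_lift_zmod_morphism.

Lemma malg_liftU k : malg_lift << k >> = h k.
Proof.
rewrite (@malg_liftEw [fset k]%fset) ?msuppU_le // big_seq_fset1 mcoeffUU.
by rewrite mulr1z.
Qed.

End Lift.

Lemma mcoeff_push_neq0 (r : K -> K) z k :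
  (malg_lift (fun j => << r j >> : {malg K}) z)@_k != 0 ->
  exists2 j, j \in msupp z & k = r j.
Proof.
move=> nz; apply: contrapT => no_j; case/eqP: nz.
rewrite raddf_sum big_seq big1 // => j zj; rewrite raddfMz /= mcoeffU.
by case: eqP => [rj|]; [case: no_j; exists j | rewrite mulr0n mul0rz].
Qed.

End FormalSums.

Section FreeModule.
Variables (G : groupType) (X : choiceType).

(** The free module over the group ring of G with basis X, as formal sums of
    pairs on which G acts by left translation of the first component. *)
Definition free_gmod : Type := {malg (G * X)%type}.
HB.instance Definition _ := GRing.Zmodule.on free_gmod.

Implicit Types (k : (G * X)%type) (z : free_gmod) (g : G) (ts : seq G).

Definition translate g k : G * X := ((g * k.1)%g, k.2).

Lemma translateM g h k : translate (g * h) k = translate g (translate h k).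
Proof. by rewrite /translate mulgA. Qed.

Lemma translate1 k : translate 1 k = k.
Proof. by case: k => g x; rewrite /translate mul1g. Qed.

Definition free_act g z : free_gmod :=
  malg_lift (fun k => << translate g k >>) z.

Fact free_act1 z : free_act 1 z = z.
Proof.
elim/malg_basis_ind: z => [|x y IHx IHy|k]; first exact: raddf0.
  by rewrite /free_act raddfB /=; congr (_ - _).
by rewrite /free_act malg_liftU translate1.
Qed.

Fact free_actM g h z : free_act (g * h) z = free_act g (free_act h z).
Proof.
rewrite /free_act; elim/malg_basis_ind: z => [|x y IHx IHy|k].
- by rewrite !raddf0.
- by rewrite !raddfB /= IHx IHy.
- by rewrite !malg_liftU translateM.
Qed.

Fact free_actD g x y : free_act g (x + y) = free_act g x + free_act g y.
Proof. exact: raddfD. Qed.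

HB.instance Definition _ :=
  isGModule.Build G free_gmod free_act1 free_actM free_actD.

Lemma gactU g k : gact g (<< k >> : free_gmod) = << translate g k >>.
Proof. exact: malg_liftU. Qed.

Lemma gact_coeff g z k : (gact g z)@_k = z@_(translate g^-1 k).
Proof.
elim/malg_basis_ind: z => [|x y IHx IHy|j].
- by rewrite raddf0 !mcoeff0.
- by rewrite raddfB /= !mcoeffB IHx IHy.
rewrite gactU !mcoeffU; congr (_ *+ nat_of_bool _); apply/eqP/eqP => [<-|->].
  by rewrite -translateM mulVg translate1.
by rewrite -translateM mulgV translate1.
Qed.

Section Orbits.
Variable ts : seq G.

Definition same_orbit k k' :=
  (k'.1 * k.1^-1 \in generated ts)%g && (k'.2 == k.2).

(** Constant on orbits, because the choice operator only depends on the extent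
    of the predicate. *)
Definition orbit_repr k : G * X := choose (same_orbit k) k.

Lemma same_orbit_repr k : same_orbit k (orbit_repr k).
Proof. by apply: chooseP; rewrite /same_orbit mulgV gpred1 eqxx. Qed.

Lemma orbit_repr_translate a k : a \in generated ts ->
  orbit_repr (translate a k) = orbit_repr k.
Proof.
move=> ga; have ak : same_orbit k (translate a k).
  by rewrite /same_orbit mulgK ga eqxx.
rewrite /orbit_repr (@eq_choose _ _ (same_orbit k)).
  by apply: choose_id => //; rewrite /same_orbit mulgV gpred1 eqxx.
by move=> k'; rewrite /same_orbit /= invgM mulgA gpredMr // gpredV.
Qed.

Lemma orbit_reprE k :
  exists2 a, a \in generated ts & orbit_repr k = translate a k.
Proof.
have /andP[ga /eqP e] := same_orbit_repr k.
exists ((orbit_repr k).1 * k.1^-1)%g => //.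
by rewrite /translate mulgVK -e -surjective_pairing.
Qed.

Lemma orbit_repr_id k : orbit_repr (orbit_repr k) = orbit_repr k.
Proof. by have [a ga {1}->] := orbit_reprE k; exact: orbit_repr_translate. Qed.

Lemma orbit_repr_inj k k' : orbit_repr k = orbit_repr k' ->
  exists2 a, a \in generated ts & k = translate a k'.
Proof.
have [a ga ->] := orbit_reprE k; have [b gb ->] := orbit_reprE k' => ab.
exists (a^-1 * b)%g; first by rewrite gpredM // gpredV.
by rewrite translateM -ab -translateM mulVg translate1.
Qed.

(** The coinvariants of the free module under the group generated by [ts], which
    are free on the orbits, are realised inside the module itself as formal sums
    of representatives. *)
Definition orbit_sum z : free_gmod := malg_lift (fun k => << orbit_repr k >>) z.

HB.instance Definition _ := GRing.isZmodMorphism.Build free_gmod free_gmod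
  orbit_sum (malg_lift_zmod_morphism _).

Lemma orbit_sumU k : orbit_sum << k >> = << orbit_repr k >>.
Proof. exact: malg_liftU. Qed.

Lemma orbit_sum_gact a z : a \in generated ts ->
  orbit_sum (gact a z) = orbit_sum z.
Proof.
move=> ga; elim/malg_basis_ind: z => [|x y IHx IHy|k].
- by rewrite raddf0.
- by rewrite !raddfB /= IHx IHy.
- by rewrite gactU !orbit_sumU orbit_repr_translate.
Qed.

Lemma orbit_sum_aug_span z : aug_span ts z -> orbit_sum z = 0.
Proof.
have: {subset ts <= generated ts} by exact: mem_generated.
elim: {1 3}ts z => [|t ts' IH] z sub_ts /=; first by move->; rewrite raddf0.
move=> [x [y [/IH Sy ->]]]; rewrite raddfD /= {}Sy ?addr0.
  by rewrite raddfB /= orbit_sum_gact ?subrr // sub_ts // mem_head.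
by move=> t' t't; rewrite sub_ts // inE t't orbT.
Qed.

Lemma aug_span_orbit_sum z : aug_span ts (z - orbit_sum z).
Proof.
elim/malg_basis_ind: z => [|x y IHx IHy|k].
- by rewrite raddf0 subrr; exact: aug_span0.
- by rewrite raddfB opprD addrACA -opprD; exact: aug_spanB.
have [a ga rk] := orbit_reprE k.
rewrite orbit_sumU rk -gactU -opprB.
by apply: aug_spanN; exact: aug_span_generated.
Qed.

End Orbits.

End FreeModule.

(** For commuting elements: the list is a basis of a free abelian group. *)
Fixpoint independent (G : groupType) (ts : seq G) : Prop :=
  if ts is t :: ts' then
    independent ts' /\ forall m, (0 < m)%N -> (t ^+ m)%g \notin generated ts'
  else True.

Section FreeRegular.
Variables (G : groupType) (X : choiceType).
Implicit Types (k : (G * X)%type) (z : free_gmod G X) (g : G) (ts : seq G).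

Lemma translate_inj k g h : translate g k = translate h k -> g = h.
Proof. by case=> /mulIg. Qed.

Lemma mem_msupp_gact g z k : k \in msupp (gact g z) ->
  exists2 j, j \in msupp z & k = translate g j.
Proof.
rewrite -mcoeff_neq0 gact_coeff mcoeff_neq0 => zk.
by exists (translate g^-1 k); rewrite // -translateM mulgV translate1.
Qed.

(** High powers of t move a finite set of orbits off itself, since each pair of
    orbits is matched by at most one power. *)
Lemma translate_disjoint ts (t : G) (z : free_gmod G X) :
    (forall m, (0 < m)%N -> (t ^+ m)%g \notin generated ts) ->
  exists m, {in msupp z &, forall k k',
    orbit_repr ts (translate (t ^+ m) k) != orbit_repr ts k'}.
Proof.
move=> t_ind.
have pair_avoid (p : (G * X) * (G * X)) : exists M, forall m, (M <= m)%N ->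
    orbit_repr ts (translate (t ^+ m) p.1) != orbit_repr ts p.2.
  have [[m0 e0]|no_m] := pselect (exists m0,
    orbit_repr ts (translate (t ^+ m0) p.1) = orbit_repr ts p.2); last first.
    by exists 0%N => m _; apply/eqP => e; apply: no_m; exists m.
  exists m0.+1 => m lt_m; apply/eqP; rewrite -e0 => /orbit_repr_inj[a ga].
  rewrite -translateM => /translate_inj tE.
  have := t_ind (m - m0)%N; rewrite subn_gt0 lt_m => /(_ isT)/negP; apply.
  by rewrite (_ : (t ^+ _)%g = a) // expgnFr 1?ltnW // tE mulgK.
have seq_avoid (r : seq ((G * X) * (G * X))) : exists M, forall m, (M <= m)%N ->
    {in r, forall p,
      orbit_repr ts (translate (t ^+ m) p.1) != orbit_repr ts p.2}.
  elim: r => [|p r [M rM]]; first by exists 0%N.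
  have [N pN] := pair_avoid p; exists (maxn M N) => m.
  rewrite geq_max => /andP[/rM rm /pN pm] q; rewrite inE => /predU1P[->|] //.
  exact: rm.
have [m rm] := seq_avoid [seq (k, k') | k <- msupp z, k' <- msupp z].
exists m => k k' zk zk'; apply: (rm m (leqnn m) (k, k')).
by apply/allpairsP; exists (k, k').
Qed.

(** If t - 1 kills z in the coinvariants, then all powers of t fix the image of
    z there; for a large power the two supports are disjoint, so this image
    is 0. *)
Lemma regular_free ts : {in ts &, forall g h, commute g h} -> independent ts ->
  regular (free_gmod G X) ts.
Proof.
elim: ts => //= t ts IH comm_ts [ind_ts t_ind].
have t_ts : {in ts, forall g, commute t g}.
  by move=> g tg; apply: comm_ts; rewrite ?mem_head // inE tg orbT.
split=> [|z Sz].
  by apply: IH => // g h tg th; apply: comm_ts; rewrite inE ?tg ?th orbT.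
have sum_act m : orbit_sum ts (gact (t ^+ m)%g z) = orbit_sum ts z.
  elim: m => [|m IHm]; first by rewrite expg0 gact1.
  apply/eqP; rewrite -{}IHm -subr_eq0 -raddfB expgSr gactM -raddfB.
  apply/eqP/orbit_sum_aug_span; rewrite /= -[gact _ _](subrK (gdiff t z)).
  apply: aug_spanD => //; apply: aug_span_gdiff => // g tg.
  by apply/commute_sym/commuteX/commute_sym; exact: t_ts.
suff sum0 : orbit_sum ts z = 0.
  by have := aug_span_orbit_sum ts z; rewrite sum0 subr0.
have [m disj] := translate_disjoint z t_ind.
apply/malgP => k; rewrite mcoeff0; apply/eqP/negP => /negP sum_k.
have [j zj kj] := mcoeff_push_neq0 sum_k.
rewrite -(sum_act m) in sum_k.
have [_ /mem_msupp_gact[j' zj' ->] kj'] := mcoeff_push_neq0 sum_k.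
by have /eqP[] := disj j' j zj' zj; rewrite -kj'.
Qed.

Section Cyclic.
Variables (c : G) (m : nat).
Hypotheses (m_gt0 : (0 < m)%N) (cm1 : (c ^+ m = 1)%g).
Hypothesis cm_min : forall i, (0 < i < m)%N -> (c ^+ i)%g <> 1%g.

Lemma expg_inj_lt i j : (i < m)%N -> (j < m)%N -> (c ^+ i = c ^+ j)%g -> i = j.
Proof.
wlog le_ij : i j / (i <= j)%N => [wl im jm e|_ jm e].
  by have [/wl->|/ltnW/wl->] // := leqP i j.
apply/eqP; rewrite eqn_leq le_ij leqNgt; apply/negP => lt_ij.
case: (@cm_min (j - i)%N).
  by rewrite subn_gt0 lt_ij (leq_ltn_trans (leq_subr _ _)).
by rewrite expgnFr // e mulgV.
Qed.

Lemma mem_expgV i : ((c ^+ i)^-1)%g \in generated [:: c].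
Proof. by rewrite gpredV gpredXn // mem_generated // mem_head. Qed.

Lemma cyclic_norm_coeff z k :
  (cyclic_norm c m z)@_k = \sum_(i < m) z@_(translate (c ^+ i)^-1 k).
Proof.
rewrite /cyclic_norm raddf_sum.
by apply: eq_bigr => i _; exact: gact_coeff.
Qed.

(** An invariant element is the norm of its restriction to a set of orbit
    representatives; an element of norm 0 has coefficients with sum 0 on each
    orbit. *)
Lemma cyclic_acyclic_free : cyclic_acyclic (free_gmod G X) c m.
Proof.
move=> z; split=> [dz0|nz0].
  have cz : gact c z = z by apply/eqP; rewrite -subr_eq0; apply/eqP.
  have z_inv a k : a \in generated [:: c] -> z@_(translate a k) = z@_k.
    rewrite -gpredV => /(generated_cyclic m_gt0 cm1)[i _ aV].
    rewrite -[a]invgK -gact_coeff aV.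
    suff -> : gact (c ^+ i)%g z = z by [].
    by elim: i {aV} => [|i IH]; [rewrite expg0 gact1 | rewrite expgSr gactM cz].
  (* The restriction of z to one representative of each orbit. *)
  pose y : free_gmod G X :=
    [malg k in msupp z => if orbit_repr [:: c] k == k then z@_k else 0].
  have yE k : y@_k = if orbit_repr [:: c] k == k then z@_k else 0.
    by rewrite mcoeffE; case: msuppP => //; rewrite if_same.
  exists y; apply/malgP => k; rewrite cyclic_norm_coeff.
  have [a ga rk] := orbit_reprE [:: c] k.
  have [i im aE] : exists2 i, (i < m)%N & (a^-1 = c ^+ i)%g.
    by apply: generated_cyclic => //; rewrite gpredV.
  rewrite (bigD1 (Ordinal im)) //= big1 ?addr0 => [|j ij].
    by rewrite -aE invgK yE -rk orbit_repr_id eqxx rk z_inv.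
  rewrite yE; case: eqP => // /esym.
  rewrite orbit_repr_translate ?mem_expgV // rk; move/translate_inj => jE.
  have /expg_inj_lt ji : (c ^+ j = c ^+ i)%g by rewrite -aE -jE invgK.
  by rewrite -val_eqE /= ji ?eqxx in ij.
have [y [_ [-> zE]]] := aug_span_orbit_sum [:: c] z.
exists y; suff sum0 : orbit_sum [:: c] z = 0.
  by rewrite -[z]subr0 -sum0 zE addr0.
have nsum0 : cyclic_norm c m (orbit_sum [:: c] z) = 0.
  have -> : orbit_sum [:: c] z = z - gdiff c y.
    by rewrite -[gdiff c y]addr0 -zE subKr.
  by rewrite raddfB /= nz0 cyclic_norm_gdiff // subr0.
apply/malgP => k; rewrite mcoeff0; apply/eqP/negP => /negP sum_k.
have [j _ kj] := mcoeff_push_neq0 sum_k.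
case/eqP: sum_k; rewrite -[RHS](mcoeff0 k) -nsum0 cyclic_norm_coeff.
rewrite (bigD1 (Ordinal m_gt0)) //= invg1 translate1 big1 ?addr0 // => i i_neq0.
apply/eqP/negP => /negP sum_i; have [j' _ kj'] := mcoeff_push_neq0 sum_i.
(* Two translates of k that are both representatives coincide. *)
have : translate (c ^+ i)^-1 k = translate 1 k.
  rewrite translate1 kj' -orbit_repr_id -kj' orbit_repr_translate ?mem_expgV //.
  by rewrite kj orbit_repr_id.
move/translate_inj/eqP; rewrite invg_eq1 => /eqP ci1.
case: (@cm_min i) => //; rewrite ltn_ord andbT lt0n.
by move: i_neq0; rewrite -val_eqE.
Qed.

End Cyclic.

End FreeRegular.

Section ProjectiveRetract.
Variables (G : groupType) (P : gmodType G).

Definition free_eval (z : free_gmod G P) : P :=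
  malg_lift (fun k => gact k.1 k.2) z.

HB.instance Definition _ := GRing.isZmodMorphism.Build (free_gmod G P) P
  free_eval (malg_lift_zmod_morphism _).

Fact free_eval_gact g z : free_eval (gact g z) = gact g (free_eval z).
Proof.
elim/malg_basis_ind: z => [|x y IHx IHy|k].
- by rewrite !raddf0.
- by rewrite !raddfB /= IHx IHy.
- by rewrite gactU /free_eval !malg_liftU gactM.
Qed.

Definition free_eval_hom : gmod_hom (free_gmod G P) P :=
  @GModHom G (free_gmod G P) P free_eval free_eval_gact.

Definition gmod_id : gmod_hom P P := @GModHom G P P idfun (fun _ _ => erefl).

Lemma projective_retract : projective P ->
  exists l : gmod_hom P (free_gmod G P), forall x, free_eval_hom (l x) = x.
Proof.
move=> /(_ _ _ free_eval_hom gmod_id) projP; apply: projP => x.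
by exists << (1%g, x) >>; rewrite /= /free_eval malg_liftU gact1.
Qed.

End ProjectiveRetract.

(** * Groups of finite cohomological dimension *)

Section CdBounds.
Variables (G : groupType) (n : nat).
Hypothesis cdG : cd_le G n.

Lemma cd_le_independent (ts : seq G) : {in ts &, forall g h, commute g h} ->
  independent ts -> (size ts <= n)%N.
Proof.
move=> comm_ts ind_ts; have [P] := cdG.
apply: (@regular_size _ _ P (mem ts)) => // i.
have [l lK] := projective_retract (@res_proj _ _ P i).
apply: (regular_retract lK); exact: regular_free.
Qed.

Lemma cd_le_torsion_free (c : G) m : (0 < m)%N -> (c ^+ m = 1)%g -> c = 1%g.
Proof.
move=> m_gt0 cm1.
have ex_m : exists i, (0 < i)%N && (c ^+ i == 1)%g.
  by exists m; rewrite m_gt0 cm1 eqxx.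
case: (ex_minnP ex_m) => k /andP[k_gt0 /eqP ck1] k_min; have [P] := cdG.
(* The exact order k of c, since the norm must run over distinct powers. *)
suff k1 : k = 1%N by move: ck1; rewrite k1 expg1.
apply: (@cyclic_acyclic_res _ _ P c) => // i.
have [l lK] := projective_retract (@res_proj _ _ P i).
apply: (cyclic_acyclic_retract lK); apply: cyclic_acyclic_free => // j.
case/andP=> j_gt0 jk cj1; have := k_min j.
by rewrite j_gt0 cj1 eqxx leqNgt jk => /(_ isT).
Qed.

End CdBounds.

(** * Binate groups have no quotients of finite cohomological dimension *)

Local Close Scope ring_scope.

Section BinateCd.
Variables (G V : groupType) (binG : binate G) (f : G -> V).
Hypothesis fM : {morph f : x y / x * y}.

(** The elements [f (y i)] of the tower at x are independent as soon as
    [f x <> 1]. *)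
Lemma binate_cd_trivial n : cd_le V n -> forall x, f x = 1.
Proof.
move=> cdV x; apply: contrapT => fx_neq1.
have f1 : f 1 = 1 by apply: (mulgI (f 1)); rewrite -fM !mulg1.
have fV y : f y^-1 = (f y)^-1.
  by apply: (mulgI (f y)); rewrite -fM !mulgV f1.
have f_comm y z : commute y z -> commute (f y) (f z).
  by rewrite /commute -!fM => ->.
have [y [u [comm_y yx yy yu]]] := binate_tower binG x.
have ind i k : independent [seq f (y j) | j <- iota i k].
  elim: k i => //= k IH i; split=> // m m_gt0; apply/negP => fy_m.
  (* Later terms of the tower commute with [u i], hence so does this power. *)
  have fu_y : commute (f (u i)) (f (y i) ^+ m).
    apply: generated_commute fy_m => _ /mapP[j + ->].
    by rewrite mem_iota => /andP[lt_ij _]; apply/f_comm/commute_sym/yu.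
  apply: fx_neq1; apply: (cd_le_torsion_free cdV m_gt0).
  have fxE : f (u i) * f (y i) * (f (u i))^-1 = f x * f (y i).
    by rewrite -fV -!fM (comm_y i) /commutator mulgVK.
  have powE k' : (f (u i) * f (y i) * (f (u i))^-1) ^+ k' =
      f (u i) * f (y i) ^+ k' * (f (u i))^-1.
    elim: k' => [|k' IHk]; first by rewrite !expg0 mulg1 mulgV.
    by rewrite !expgS IHk -!mulgA mulKg.
  have := powE m; rewrite fxE fu_y mulgK expgMn; last first.
    by apply/f_comm/commute_sym/yx.
  by rewrite -[RHS]mul1g => /mulIg.
suff comm_fy : {in [seq f (y i) | i <- iota 0 n.+1] &, forall g h, commute g h}.
  have := cd_le_independent cdV comm_fy (ind 0 n.+1).
  by rewrite size_map size_iota ltnn.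
move=> _ _ /mapP[i _ ->] /mapP[j _ ->].
apply: f_comm; have [lt_ij|lt_ji|->] := ltngtP i j; last exact: commute_refl.
  by apply/commute_sym/yy.
exact: yy.
Qed.

End BinateCd.

Lemma binate_vcd_trivial (G V : groupType) (f : group_hom G V) :
  binate G -> finite_vcd V -> forall x, f x = 1.
Proof.
move=> binG [H [finH [n cdH]]] x.
have fH y : f y \in H by exact: binate_finite_index.
pose fr y : subgroup H := Sub (f y) (fH y).
have frM : {morph fr : y z / y * z}.
  by move=> y z; apply: val_inj; rewrite gmulfM !SubK gmulfM.
have := congr1 val (binate_cd_trivial binG frM cdH x).
by rewrite SubK gmulf1.
Qed.

Theorem theorem3p9 (G Q : groupType) (hG : binate G)
    (hQ : residually_finite_vcd Q) (f : group_hom G Q) :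
  forall x : G, f x = 1%g.
Proof.
move=> x; apply: contrapT => /hQ[V [g [vcdV]]]; apply.
have := @binate_vcd_trivial G V (g \o f) hG vcdV x.
exact.
Qed.
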